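(* Let $a$, $b$, $c$ be positive integers with $c$ even. Then for all integers $p,q\geq1$ and all $x,y,z\in\mathbb{R}$, \begin{align*} a^{1-p}b^{1-q}S^{(2)}_{p,q}(a,b,c:x,y,z) &=-\frac{q}{2}\sum_{j=0}^{p}\binom{p}{j}a^{1-j}c^{1+j-p-q}S^{(1)}_{p+q-j,j}(c,-a,b:z,x,y)\\ &\quad-\frac{p}{2}\sum_{h=0}^{q}\binom{q}{h}(-1)^{h}b^{1-h}c^{1+h-p-q}S^{(1)}_{p+q-h,h}(c,b,a:z,-y,x). \end{align*}
   Context: $B_n(x)$ is the $n$th Bernoulli polynomial ($\frac{te^{xt}}{e^t-1}=\sum B_n(x)\frac{t^n}{n!}$) and $\mathcal{B}_n(x)=B_n(x-[x])$ the $n$th Bernoulli function ($[x]$ the largest integer $\le x$; $\mathcal{B}_0\equiv1$). $E_n(x)$ is the $n$th Euler polynomial ($\frac{2e^{xt}}{e^t+1}=\sum E_n(x)\frac{t^n}{n!}$), and the Euler function $\mathcal{E}_n$ ($n\ge0$) is defined by $\mathcal{E}_n(x)=E_n(x)$ for $0\le x<1$ and $\mathcal{E}_n(x+m)=(-1)^m\mathcal{E}_n(x)$ for $m\in\mathbb{Z}$. For integers $a,b$, a positive integer $c$, and real $x,y,z$ define, for integers $p\ge1$, $q\ge0$, $$S^{(1)}_{p,q}(a,b,c:x,y,z)=\sum_{\mu=0}^{c-1}\mathcal{E}_{p-1}\Big(a\frac{\mu+z}{c}+x\Big)\mathcal{B}_{q}\Big(b\frac{\mu+z}{c}+y\Big),$$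 and, for integers $p,q\ge1$, $$S^{(2)}_{p,q}(a,b,c:x,y,z)=\sum_{\mu=0}^{c-1}(-1)^{\mu}\mathcal{B}_{p}\Big(a\frac{\mu+z}{c}+x\Big)\mathcal{B}_{q}\Big(b\frac{\mu+z}{c}+y\Big).$$ *)

(* Defs.v *)
From HB Require Import structures.
From mathcomp Require Import all_boot all_order all_algebra.
From mathcomp Require Import reals.
Set Implicit Arguments. Unset Strict Implicit. Unset Printing Implicit Defensive.
Import Order.TTheory GRing.Theory Num.Theory.
Local Open Scope ring_scope.

Section Defs.
Variable R : realType.

(* Bernoulli polynomials B_0(x),...,B_n(x) from the coefficient form of the
   generating function  (e^t - 1) * sum B_n(x) t^n/n! = t e^{xt}, i.e.
   sum_{k=0}^{n} C(n+1,k) B_k(x) = (n+1) x^n. *)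
Fixpoint bern_list (x : R) (n : nat) : seq R :=
  match n with
  | 0 => [:: 1]
  | m.+1 => let l := bern_list x m in
      rcons l (x ^+ n - (n.+1)%:R^-1 *
                 \sum_(k < n) 'C(n.+1, k)%:R * nth 0 l k)
  end.
Definition bernoulli_poly (n : nat) (x : R) : R := nth 0 (bern_list x n) n.

(* Euler polynomials from  (e^t + 1) * sum E_n(x) t^n/n! = 2 e^{xt}, i.e.
   sum_{k=0}^{n} C(n,k) E_k(x) + E_n(x) = 2 x^n. *)
Fixpoint euler_list (x : R) (n : nat) : seq R :=
  match n with
  | 0 => [:: 1]
  | m.+1 => let l := euler_list x m in
      rcons l (x ^+ n - 2^-1 * \sum_(k < n) 'C(n, k)%:R * nth 0 l k)
  end.
Definition euler_poly (n : nat) (x : R) : R := nth 0 (euler_list x n) n.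

Definition bernoulli_fun (n : nat) (x : R) : R :=
  bernoulli_poly n (x - (Num.floor x)%:~R).

(* Euler function: E_n on [0,1), with E(x+m) = (-1)^m E(x). *)
Definition euler_fun (n : nat) (x : R) : R :=
  (-1) ^ (Num.floor x) * euler_poly n (x - (Num.floor x)%:~R).

Definition S1 (p q : nat) (a b : int) (c : nat) (x y z : R) : R :=
  \sum_(mu < c) euler_fun (p.-1) (a%:~R * ((mu%:R + z) / c%:R) + x)
                * bernoulli_fun q (b%:~R * ((mu%:R + z) / c%:R) + y).

Definition S2 (p q : nat) (a b : int) (c : nat) (x y z : R) : R :=
  \sum_(mu < c) (-1) ^+ mu * bernoulli_fun p (a%:~R * ((mu%:R + z) / c%:R) + x)
                * bernoulli_fun q (b%:~R * ((mu%:R + z) / c%:R) + y).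

End Defs.

(* Main.v *)
Require Import Defs.
From HB Require Import structures.
From mathcomp Require Import all_boot all_order all_algebra.
From mathcomp Require Import reals.
From mathcomp Require Import zify ring lra.
Import Order.TTheory GRing.Theory Num.Theory.
Local Open Scope ring_scope.

(** Put Z = (mu+z)/c, X = (i+x)/a and Y = (k+y)/b. By Raabe's multiplication
    formula, and by its analogue writing an Euler function as an alternating
    sum of c Bernoulli functions (c even), both sides are sums over mu, i, k of
    (-1)^mu times a function of u = Z+X and v = Z+Y: the left-hand summand is
    B_p(u) B_q(v), the right-hand one a combination of the
    B_{p+q-j}(v) B_j(u-v) and the (-1)^h B_{p+q-h}(u) B_h(u-v). Their difference
    depends on u - v = X - Y only (Nielsen): as a polynomial in v with u - v
    fixed it has period 1, hence is constant. As c is even, the sum over mu of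
    (-1)^mu times a function of X - Y vanishes. The difference equations hold
    exactly for the right-continuous Bernoulli functions, so no exception is
    needed at their jumps. *)

(** * Recurrences characterizing the Bernoulli and Euler polynomials *)

Lemma size_bern_list (R : realType) (x : R) n : size (bern_list x n) = n.+1.
Proof. by elim: n => //= n IHn; rewrite size_rcons IHn. Qed.

Lemma nth_bern_list (R : realType) (x : R) n k :
  (k <= n)%N -> nth 0 (bern_list x n) k = bernoulli_poly k x.
Proof.
elim: n => [|n IHn]; first by rewrite leqn0 => /eqP->.
rewrite leq_eqVlt => /orP[/eqP-> //|lekn].
by rewrite [bern_list x n.+1]/= nth_rcons size_bern_list lekn IHn.
Qed.

Lemma bernoulli_poly_rec (R : realType) (x : R) n :
  \sum_(k < n.+1) 'C(n.+1, k)%:R * bernoulli_poly k x = n.+1%:R * x ^+ n.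
Proof.
case: n => [|n]; first by rewrite big_ord1 /bernoulli_poly /= bin0 expr0.
rewrite big_ord_recr /= {2}/bernoulli_poly /= nth_rcons size_bern_list ltnn eqxx.
rewrite binSn (eq_bigr (fun k : 'I_n.+1 =>
  'C(n.+2, k)%:R * nth 0 (bern_list x n) k)); last first.
  by move=> k _; rewrite nth_bern_list // -ltnS.
rewrite mulrBr mulrA divff ?pnatr_eq0 // mul1r; ring.
Qed.

(** The top term has the invertible coefficient n+1, so the recurrence determines the sequence.
    Identities for B_n are proved below by checking this recurrence, in place of generating
    functions. *)
Lemma bernoulli_poly_uniq (R : realType) (x : R) (f : nat -> R) :
    (forall n, \sum_(k < n.+1) 'C(n.+1, k)%:R * f k = n.+1%:R * x ^+ n) ->
  forall n, f n = bernoulli_poly n x.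
Proof.
move=> f_rec; elim/ltn_ind => n IHn.
have /eqP := f_rec n; rewrite -bernoulli_poly_rec !big_ord_recr /=.
rewrite (eq_bigr (fun k : 'I_n => 'C(n.+1, k)%:R * bernoulli_poly k x)); last first.
  by move=> k _; rewrite IHn.
rewrite (inj_eq (addrI _)) (inj_eq (mulfI _)) ?binSn ?pnatr_eq0 //.
by move/eqP.
Qed.

Lemma size_euler_list (R : realType) (x : R) n : size (euler_list x n) = n.+1.
Proof. by elim: n => //= n IHn; rewrite size_rcons IHn. Qed.

Lemma nth_euler_list (R : realType) (x : R) n k :
  (k <= n)%N -> nth 0 (euler_list x n) k = euler_poly k x.
Proof.
elim: n => [|n IHn]; first by rewrite leqn0 => /eqP->.
rewrite leq_eqVlt => /orP[/eqP-> //|lekn].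
by rewrite [euler_list x n.+1]/= nth_rcons size_euler_list lekn IHn.
Qed.

Lemma euler_poly_rec (R : realType) (x : R) n :
  \sum_(k < n.+1) 'C(n, k)%:R * euler_poly k x + euler_poly n x = 2 * x ^+ n.
Proof.
case: n => [|n]; first by rewrite big_ord1 /euler_poly /= bin0 expr0; ring.
rewrite big_ord_recr /= {2 3}/euler_poly /= nth_rcons size_euler_list ltnn eqxx.
rewrite binn (eq_bigr (fun k : 'I_n.+1 =>
  'C(n.+1, k)%:R * nth 0 (euler_list x n) k)); last first.
  by move=> k _; rewrite nth_euler_list // -ltnS.
by field.
Qed.

Lemma euler_poly_uniq (R : realType) (x : R) (f : nat -> R) :
    (forall n, \sum_(k < n.+1) 'C(n, k)%:R * f k + f n = 2 * x ^+ n) ->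
  forall n, f n = euler_poly n x.
Proof.
move=> f_rec; elim/ltn_ind => n IHn.
have := f_rec n; rewrite -euler_poly_rec !big_ord_recr /= binn.
rewrite (eq_bigr (fun k : 'I_n => 'C(n, k)%:R * euler_poly k x)); last first.
  by move=> k _; rewrite IHn.
lra.
Qed.

(** Both products are the trinomial coefficient n! / (j! (k-j)! (n-k)!). *)
Lemma mul_bin_bin n k j : (j <= k <= n)%N ->
  ('C(n, k) * 'C(k, j) = 'C(n, k - j) * 'C(n - (k - j), j))%N.
Proof.
move=> /andP[lejk lekn]; have e1 : (n - (k - j) = n - k + j)%N by lia.
have l1 : (k - j <= n)%N by lia.
have l2 : (j <= n - (k - j))%N by lia.
apply/eqP; rewrite -(eqn_pmul2r (_ : 0 < j`! * (k - j)`! * (n - k)`!)%N)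
  ?muln_gt0 ?fact_gt0 //.
apply/eqP; transitivity n`!.
  by rewrite -(bin_fact lekn) -(bin_fact lejk); ring.
by rewrite -(bin_fact l1) -(bin_fact l2) e1 addnK; ring.
Qed.

(** * Addition theorem, difference equation and reflection *)

Lemma bernoulli_polyD (R : realType) (x y : R) n :
  bernoulli_poly n (x + y) =
  \sum_(k < n.+1) 'C(n, k)%:R * bernoulli_poly k x * y ^+ (n - k).
Proof.
symmetry; move: n.
apply: (bernoulli_poly_uniq _ _ (fun n => \sum_(k < n.+1) 'C(n, k)%:R *
  bernoulli_poly k x * y ^+ (n - k))) => n.
(* Here m is the exponent of y. For fixed m the sum over k is the recurrence at x of order n-m; the
   binomial theorem then collects the powers of y. *)
transitivity (\sum_(k < n.+1) \sum_(m < n.+1 | (m <= k)%N)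
   'C(n.+1, m)%:R * y ^+ m * ('C(n.+1 - m, k - m)%:R * bernoulli_poly (k - m) x)).
  apply: eq_bigr => k _; rewrite mulr_sumr (reindex_inj rev_ord_inj) /=.
  rewrite (big_ord_widen_cond n.+1 xpredT
    (fun j => 'C(n.+1, k)%:R * ('C(k, k.+1 - j.+1)%:R * bernoulli_poly (k.+1 - j.+1) x *
      y ^+ (k - (k.+1 - j.+1))))) //.
  apply: eq_big => [j|j]; rewrite ltnS // => lejk.
  rewrite !subSS subKn // -2!mulrA mulrA -natrM mul_bin_bin ?leq_subr 1?ltnW // subKn //.
  by rewrite natrM; ring.
rewrite (exchange_big_dep xpredT) //=.
transitivity (\sum_(m < n.+1) 'C(n.+1, m)%:R * y ^+ m * ((n.+1 - m)%:R * x ^+ (n - m))).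
  apply: eq_bigr => m _; rewrite -mulr_sumr; congr (_ * _).
  have lemn : (m <= n)%N by rewrite -ltnS.
  rewrite subSn // -bernoulli_poly_rec.
  rewrite -(big_mkord (fun i => (m <= i)%N) (fun i => 'C((n - m).+1, i - m)%:R *
    bernoulli_poly (i - m) x)).
  rewrite (big_cat_nat _ (n := m)) //=; last by rewrite ltnW.
  rewrite big_nat_cond big_pred0 ?add0r; last by move=> i; lia.
  rewrite -[X in index_iota X n.+1]add0n big_addn big_mkord subSn //.
  by apply: eq_big => i; rewrite ?addnK ?leq_addl.
rewrite exprDn mulr_sumr; apply: eq_bigr => m _.
have lemn : (m <= n)%N by rewrite -ltnS.
have := congr1 (GRing.natmul (1 : R)) (mul_bin_down n.+1 m); rewrite !natrM.
rewrite [n.+1.-1]/= -(mulr_natr (_ * _)) => h.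
by rewrite mulrACA ['C(_, _)%:R * _]mulrC -h; ring.
Qed.

Lemma bernoulli_polyS (R : realType) (x : R) n :
  bernoulli_poly n (x + 1) = bernoulli_poly n x + n%:R * x ^+ n.-1.
Proof.
case: n => [|n]; first by rewrite mul0r addr0.
rewrite bernoulli_polyD big_ord_recr /= subnn binn -bernoulli_poly_rec addrC.
rewrite mulr1 mul1r; congr (_ + _).
by apply: eq_bigr => k _; rewrite expr1n mulr1.
Qed.

(** The sequence (-1)^n B_n(1-x) satisfies the recurrence at x: expand B_{n+1}(-x) around 1-x with
    increment -1, and replace the top term B_{n+1}(1-x) by the difference equation at -x. *)
Lemma bernoulli_poly_reflection (R : realType) (x : R) n :
  bernoulli_poly n (1 - x) = (-1) ^+ n * bernoulli_poly n x.
Proof.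
rewrite -(bernoulli_poly_uniq _ x (fun n => (-1) ^+ n * bernoulli_poly n (1 - x))).
  by rewrite mulrA -expr2 sqrr_sign mul1r.
move=> {}n; have := bernoulli_polyD R (1 - x) (-1) n.+1.
have := bernoulli_polyS R (- x) n.+1.
rewrite /= big_ord_recr /= subnn binn mul1r mulr1 addrAC subrr add0r [- x + 1]addrC.
move=> -> /(congr1 (fun u => (-1) ^+ n.+1 * u)).
rewrite (exprNn x); move: (bernoulli_poly n.+1 (- x)) => B.
rewrite mulrDr mulr_sumr => h.
transitivity (\sum_(k < n.+1) (-1) ^+ n.+1 * ('C(n.+1, k)%:R * bernoulli_poly k (1 - x) *
  (-1) ^+ (n.+1 - k)) : R).
  apply: eq_bigr => k _.
  have -> : (-1) ^+ n.+1 = (-1) ^+ (n.+1 - k) * (-1)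
    ^+ k :> R by rewrite -exprD subnK // ltnW.
  move: (sqrr_sign R (n.+1 - k)); rewrite expr2; move: (_ ^+ (_ - _)) => s hs.
  move: ((-1) ^+ k) (bernoulli_poly _ _) => u v.
  transitivity (s * s * ('C(n.+1, k)%:R * (u * v))); last by ring.
  by rewrite hs mul1r.
move: h; have := sqrr_sign R n; rewrite expr2 exprS.
move: ((-1) ^+ n) => s; set S := \sum_(i < _) _ => hs h.
apply/eqP; rewrite -subr_eq0; apply/eqP.
transitivity (n.+1%:R * x ^+ n * (s * s - 1)); last by rewrite hs; ring.
by rewrite -[S](addrK (-1 * s * (B + n.+1%:R * (s * x ^+ n)))) -h; ring.
Qed.

(** * Multiplication formulas for the polynomials *)

Lemma sum_ord_shift (R : pzRingType) (s : R) (g : nat -> R) n :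
  s * (\sum_(i < n) s ^+ i * g i.+1) = \sum_(i < n) s ^+ i * g i + s ^+ n * g n - g 0%N.
Proof.
have -> : \sum_(i < n) s ^+ i * g i + s ^+ n * g n = \sum_(i < n.+1) s ^+ i * g i.
  by rewrite big_ord_recr.
rewrite big_ord_recl mul1r /= addrC addKr mulr_sumr.
by apply: eq_bigr => i _; rewrite mulrA -exprS.
Qed.

Lemma sum_sign_even (R : realType) c : ~~ odd c -> \sum_(i < c) (-1) ^+ i = 0 :> R.
Proof.
move=> c_even; have := sum_ord_shift R (-1) (fun=> 1) c.
rewrite -signr_odd (negbTE c_even); under eq_bigr do rewrite mulr1.
by move: (\sum_(i < c) _) => S; lra.
Qed.

(** The normalized sum [F] satisfies the recurrence because [F n.+1 (x + 1)] can be computed twice: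
    by the addition theorem with increment 1/a ([FD]), and by shifting the index i, where only the
    two end terms survive ([FS]). *)
Lemma bernoulli_poly_raabe (R : realType) a (x : R) n : (0 < a)%N ->
  \sum_(i < a) bernoulli_poly n ((x + i%:R) / a%:R) =
  a%:R ^ (1 - n%:Z) * bernoulli_poly n x.
Proof.
move=> a_gt0; have a0 : a%:R != 0 :> R by rewrite pnatr_eq0 -lt0n.
pose F k y := a%:R ^+ k / a%:R * \sum_(i < a) bernoulli_poly k ((y + i%:R) / a%:R) : R.
suff <- : F n x = bernoulli_poly n x.
  by rewrite /F expfzDr // -exprnN expr1z; field; rewrite a0 expf_neq0.
apply: (bernoulli_poly_uniq _ x (F^~ x)) => {}n.
have FD : F n.+1 (x + 1) = \sum_(k < n.+2) 'C(n.+1, k)%:R * F k x.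
  rewrite /F; under eq_bigr => i _.
    rewrite addrAC mulrDl bernoulli_polyD; over.
  rewrite exchange_big /= mulr_sumr; apply: eq_bigr => k _.
  rewrite -mulr_suml -mulr_sumr mul1r exprVn.
  have -> : a%:R ^+ n.+1 = a%:R ^+ (n.+1 - k) *
    a%:R ^+ k :> R by rewrite -exprD subnK // -ltnS.
  by field; rewrite expf_neq0 ?a0.
have FS : F n.+1 (x + 1) = F n.+1 x + n.+1%:R * x ^+ n.
  have := sum_ord_shift R 1 (fun i => bernoulli_poly n.+1 ((x + i%:R) / a%:R)) a.
  rewrite mul1r expr1n mul1r.
  under eq_bigr do rewrite expr1n mul1r.
  under [in X in _ = X -> _]eq_bigr do rewrite expr1n mul1r.
  rewrite /F => h.
  under eq_bigr do rewrite -addrA nat1r.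
  rewrite h addr0 mulrDl divff // bernoulli_polyS expr_div_n /=.
  by rewrite exprS; field; rewrite a0 expf_neq0.
by move: FD; rewrite FS big_ord_recr /= binn mul1r; lra.
Qed.

(** The same double computation as for Raabe's formula, at x+1. The alternating signs turn the
    difference of the two shifted sums into a sum, which is the form of the Euler recurrence. *)
Lemma euler_poly_bernoulli (R : realType) c (x : R) n : (0 < c)%N -> ~~ odd c ->
  c%:R ^+ n * (- 2 / n.+1%:R) *
    (\sum_(i < c) (-1) ^+ i * bernoulli_poly n.+1 ((x + i%:R) / c%:R)) =
  euler_poly n x.
Proof.
move=> c_gt0 c_even; have c0 : c%:R != 0 :> R by rewrite pnatr_eq0 -lt0n.
pose F k y := c%:R ^+ k * (- 2 / k.+1%:R) *
  (\sum_(i < c) (-1) ^+ i * bernoulli_poly k.+1 ((y + i%:R) / c%:R)) : R.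
apply: (euler_poly_uniq _ x (F^~ x)) => {}n.
have FD : F n (x + 1) = \sum_(k < n.+1) 'C(n, k)%:R * F k x.
  rewrite /F; under eq_bigr => i _.
    rewrite addrAC mulrDl bernoulli_polyD mulr_sumr; over.
  (* The term in B_0 = 1 is an alternating sum of ones, zero for even c. Dropping it lowers the
     degree by one, from B_{k+1} to E_k. *)
  rewrite exchange_big /= big_ord_recl.
  under eq_bigr do rewrite /bernoulli_poly /= mulrA.
  rewrite -mulr_suml -mulr_suml sum_sign_even // !mul0r add0r mulr_sumr;
    apply: eq_bigr => k _.
  rewrite mul1r exprVn subSS.
  transitivity (c%:R ^+ n * (- 2 / n.+1%:R) * ('C(n.+1, k.+1)%:R / c%:R ^+ (n - k))
    * \sum_(i < c) (-1) ^+ i * bernoulli_poly k.+1 ((x + i%:R) / c%:R)).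
    by rewrite -!mulrA; congr (_ * (_ * (_ * _))); rewrite !mulr_sumr;
      apply: eq_bigr => i _; rewrite /bump /=; ring.
  rewrite [RHS]mulrA; congr (_ * _).
  have -> : c%:R ^+ n = c%:R ^+ (n - k) * c%:R ^+ k :> R by rewrite -exprD subnK // -ltnS.
  have := congr1 (GRing.natmul (1 : R)) (mul_bin_diag n.+1 k); rewrite !natrM => /= h.
  have -> : 'C(n, k)%:R = k.+1%:R * 'C(n.+1, k.+1)%:R / n.+1%:R :> R by rewrite -h;
    field; rewrite nat1r pnatr_eq0.
  by field; rewrite expf_neq0 ?c0 // !nat1r !pnatr_eq0.
have FS : F n (x + 1) + F n x = 2 * x ^+ n.
  have := sum_ord_shift R (-1) (fun i => bernoulli_poly n.+1 ((x + i%:R) / c%:R)) c.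
  rewrite -(signr_odd _ c) (negbTE c_even)
    mul1r addr0 mulrDl divff // bernoulli_polyS expr_div_n /=.
  rewrite /F => h.
  under eq_bigr do rewrite -addrA nat1r.
  move: h; set S := \sum_(i < c) _; set T := \sum_(i < c) _ => h.
  have -> : S = - (T + n.+1%:R * (x ^+ n / c%:R ^+ n)) by lra.
  by field; rewrite expf_neq0 ?c0 // !nat1r !pnatr_eq0.
by rewrite -FD.
Qed.

(** * Nielsen's expansion of a product of Bernoulli polynomials *)

Lemma poly_periodic_const (R : realType) (P : {poly R}) :
  (forall v, P.[v + 1] = P.[v]) -> forall v, P.[v] = P.[0].
Proof.
move=> PS; have P_nat m : P.[m%:R] = P.[0].
  by elim: m => // m IHm; rewrite -natr1 PS.
(* This difference vanishes at every natural number, hence at as many distinct points as its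
   size. *)
suff /subr0_eq-> : P - P.[0]%:P = 0 by move=> v; rewrite !hornerC.
apply: (@roots_geq_poly_eq0 _ _ [seq m%:R | m <- iota 0 (size (P - P.[0]%:P))]).
- by apply/allP => _ /mapP[m _ ->]; rewrite /root !hornerE P_nat subrr.
- by rewrite map_inj_uniq ?iota_uniq //; apply: (mulrIn (oner_neq0 R)).
- by rewrite size_map size_iota.
Qed.

(** [bernoulli_poly] is computed pointwise; counting roots needs a formal polynomial, read off from
    the addition theorem at 0. *)
Definition bernoulli_polyX {R : realType} n : {poly R} :=
  \sum_(k < n.+1) ('C(n, k)%:R * bernoulli_poly k 0) *: 'X^(n - k).

Lemma horner_bernoulli_polyX {R : realType} n (x : R) :
  (bernoulli_polyX n).[x] = bernoulli_poly n x.
Proof.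
rewrite -[x in RHS]add0r bernoulli_polyD horner_sum.
by apply: eq_bigr => k _; rewrite !hornerE.
Qed.

(** One half of Nielsen's expansion. [F] and [G] are arbitrary sequences so that it serves both the
    polynomials and the periodic functions. For q > 0 the divisor p+q-j is never zero. *)
Definition convol {R : realType} (p q : nat) (F G : nat -> R) : R :=
  \sum_(j < p.+1) 'C(p, j)%:R / (p + q - j)%:R * F (p + q - j)%N * G j.

(* Nielsen's expansion of the product [U p * V q] is the vanishing of [defect]
   up to a term depending only on [W]. *)
Definition defect {R : realType} (p q : nat) (U V W : nat -> R) : R :=
  U p * V q - q%:R * convol p q V W
            - p%:R * convol q p U (fun h => (-1) ^+ h * W h).

(** The difference equation cancels the divisor p+q-j, and what remains is v^(q-1) times the
    addition theorem for B_p(w+v). Taking [G] up to pointwise equality admits (-1)^h B_h(w), which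
    is B_h(1-w) by reflection. *)
Lemma convolS {R : realType} p q (v w : R) (G : nat -> R) : (0 < q)%N ->
    (forall j, G j = bernoulli_poly j w) ->
  convol p q ((@bernoulli_poly R)^~ (v + 1)) G =
  convol p q ((@bernoulli_poly R)^~ v) G + v ^+ q.-1 * bernoulli_poly p (w + v).
Proof.
move=> q_gt0 GE; rewrite /convol bernoulli_polyD mulr_sumr -big_split /=.
apply: eq_bigr => j _; rewrite bernoulli_polyS GE.
have lejp : (j <= p)%N by rewrite -ltnS.
have -> : ((p + q - j).-1 = q.-1 + (p - j))%N by lia.
rewrite exprD; have : (p + q - j)%:R != 0 :> R by rewrite pnatr_eq0; lia.
by move: (p + q - j)%N => m m0; field.
Qed.

(** The product grows by q v^(q-1) B_p(v+w) + p (v+w)^(p-1) B_q(v+1), and [convolS] gives exactly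
    these two terms for the two halves. *)
Lemma defect_shift {R : realType} p q (v w : R) : (0 < p)%N -> (0 < q)%N ->
  defect p q ((@bernoulli_poly R)^~ (v + w + 1)) ((@bernoulli_poly R)^~ (v + 1))
    ((@bernoulli_poly R)^~ w) =
  defect p q ((@bernoulli_poly R)^~ (v + w)) ((@bernoulli_poly R)^~ v)
    ((@bernoulli_poly R)^~ w).
Proof.
move=> p_gt0 q_gt0; rewrite /defect (convolS _ _ _ w) //.
rewrite (convolS _ _ _ (1 - w)) //; last by move=> j; rewrite bernoulli_poly_reflection.
have -> : 1 - w + (v + w) = v + 1 by ring.
by rewrite (addrC w v) !bernoulli_polyS; ring.
Qed.

(** Fractional parts need not add up: the one of u may be one less than v+w. Moving u alone by 1
    changes the product and the second half by the same p u^(p-1) B_q(v), and leaves the first half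
    untouched. *)
Lemma defect_wrap {R : realType} p q (u v w : R) : (0 < p)%N -> u + 1 = v + w ->
  defect p q ((@bernoulli_poly R)^~ u) ((@bernoulli_poly R)^~ v) ((@bernoulli_poly R)^~ w) =
  defect p q ((@bernoulli_poly R)^~ (v + w)) ((@bernoulli_poly R)^~ v)
    ((@bernoulli_poly R)^~ w).
Proof.
move=> p_gt0 uE; rewrite -uE /defect (convolS _ _ _ (1 - w)) //; last first.
  by move=> j; rewrite bernoulli_poly_reflection.
have -> : 1 - w + u = v by rewrite -[v](addrK w) -uE; ring.
by rewrite bernoulli_polyS; ring.
Qed.

Lemma defect_const {R : realType} p q (v w : R) : (0 < p)%N -> (0 < q)%N ->
  defect p q ((@bernoulli_poly R)^~ (v + w)) ((@bernoulli_poly R)^~ v)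
    ((@bernoulli_poly R)^~ w) =
  defect p q ((@bernoulli_poly R)^~ w) ((@bernoulli_poly R)^~ 0) ((@bernoulli_poly R)^~ w).
Proof.
move=> p_gt0 q_gt0.
suff [P PE] : exists P : {poly R}, forall v, P.[v] =
    defect p q ((@bernoulli_poly R)^~ (v + w)) ((@bernoulli_poly R)^~ v)
      ((@bernoulli_poly R)^~ w).
  rewrite -PE poly_periodic_const ?PE ?add0r // => {}v.
  by rewrite !PE addrAC defect_shift.
pose bw n := bernoulli_polyX n \Po ('X + w%:P).
have bwE n x : (bw n).[x] = bernoulli_poly n (x + w).
  by rewrite horner_comp !hornerE horner_bernoulli_polyX.
exists (bw p * bernoulli_polyX q
  - q%:R *: (\sum_(j < p.+1) ('C(p, j)%:R / (p + q - j)%:R * bernoulli_poly j w)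
    *: bernoulli_polyX (p + q - j)%N)
  - p%:R *: (\sum_(h < q.+1) ('C(q, h)%:R / (q + p - h)%:R * ((-1) ^+ h *
    bernoulli_poly h w)) *: bw (q + p - h)%N)) => x.
rewrite !hornerE !bwE !horner_bernoulli_polyX /defect /convol; congr (_ - _ * _ - _ * _).
- rewrite horner_sum; apply: eq_bigr => j _; rewrite hornerZ horner_bernoulli_polyX; ring.
- rewrite horner_sum; apply: eq_bigr => j _; rewrite hornerZ bwE; ring.
Qed.

(** * The periodic Bernoulli and Euler functions *)

Lemma real_shift_ind (R : realType) (P : R -> Prop) :
    (forall x, P x <-> P (x + 1)) -> (forall x, 0 <= x < 1 -> P x) ->
  forall x, P x.
Proof.
move=> PS P01 x; rewrite -[x](subrK (Num.floor x)%:~R).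
have : P (x - (Num.floor x)%:~R).
  by apply: P01; have := floor_itv x; rewrite intrD; lra.
move: (Num.floor x) (x - (Num.floor x)%:~R) => m r Pr.
elim/int_ind: m => [|n IHn|n IHn]; first by rewrite addr0.
  by rewrite -addn1 PoszD intrD addrA -PS.
by apply/PS; rewrite -addn1 PoszD opprD intrD addrA subrK.
Qed.

Lemma floorS (R : realType) (x : R) : Num.floor (x + 1) = Num.floor x + 1.
Proof. by apply: floor_def; have := floor_itv x; rewrite !intrD; lra. Qed.

Lemma floor_itv01 (R : realType) (x : R) : 0 <= x < 1 -> Num.floor x = 0.
Proof. by move=> x01; apply: floor_def; rewrite add0r. Qed.

Lemma bernoulli_funS (R : realType) n (x : R) :
  bernoulli_fun n (x + 1) = bernoulli_fun n x.
Proof. by rewrite /bernoulli_fun floorS intrD mulr1z opprD addrACA subrr addr0. Qed.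

Lemma euler_funS (R : realType) n (x : R) :
  euler_fun n (x + 1) = - euler_fun n x.
Proof.
rewrite /euler_fun floorS intrD mulr1z opprD addrACA subrr addr0.
by rewrite expfzDr ?oppr_eq0 ?oner_eq0 // expr1z; ring.
Qed.

Lemma bernoulli_fun01 (R : realType) n (x : R) :
  0 <= x < 1 -> bernoulli_fun n x = bernoulli_poly n x.
Proof. by move=> x01; rewrite /bernoulli_fun floor_itv01 // subr0. Qed.

Lemma euler_fun01 (R : realType) n (x : R) :
  0 <= x < 1 -> euler_fun n x = euler_poly n x.
Proof. by move=> x01; rewrite /euler_fun floor_itv01 // subr0 mul1r. Qed.

Lemma div_itv01 (R : realType) a (i : 'I_a) (x : R) :
  0 <= x < 1 -> 0 <= (x + i%:R) / a%:R < 1.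
Proof.
move=> /andP[x0 x1]; have a_gt0 : 0 < a%:R :> R by rewrite ltr0n (leq_trans _ (ltn_ord i)).
rewrite divr_ge0 ?addr_ge0 ?ler0n //= ltr_pdivrMr // mul1r.
have : i.+1%:R <= a%:R :> R by rewrite ler_nat.
by rewrite -natr1; lra.
Qed.

(** Both sides have period 1, since x+1 only permutes the terms cyclically. On [0,1) every (x+i)/a
    lies in [0,1) as well, and the polynomial formula applies. *)
Lemma bernoulli_fun_raabe (R : realType) a (x : R) n : (0 < a)%N ->
  \sum_(i < a) bernoulli_fun n ((x + i%:R) / a%:R) =
  a%:R ^ (1 - n%:Z) * bernoulli_fun n x.
Proof.
move=> a_gt0; have a0 : a%:R != 0 :> R by rewrite pnatr_eq0 -lt0n.
move: x; apply: real_shift_ind => x; last first.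
  move=> x01; rewrite bernoulli_fun01 // -bernoulli_poly_raabe //.
  by apply: eq_bigr => i _; rewrite bernoulli_fun01 // div_itv01.
rewrite bernoulli_funS.
have := sum_ord_shift R 1 (fun i => bernoulli_fun n ((x + i%:R) / a%:R)) a.
rewrite mul1r expr1n mul1r addr0 mulrDl divff // bernoulli_funS addrK.
under eq_bigr do rewrite expr1n mul1r -nat1r addrA.
by under [in X in _ = X -> _]eq_bigr do rewrite expr1n mul1r; move->.
Qed.

(** Reversing i turns x-i into x-(a-1)+i, and periodicity absorbs a-1. *)
Lemma bernoulli_fun_raabeN (R : realType) a (x : R) n : (0 < a)%N ->
  \sum_(i < a) bernoulli_fun n ((x - i%:R) / a%:R) =
  a%:R ^ (1 - n%:Z) * bernoulli_fun n x.
Proof.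
move=> a_gt0; have a0 : a%:R != 0 :> R by rewrite pnatr_eq0 -lt0n.
have BN m : bernoulli_fun n (x - m%:R) = bernoulli_fun n x.
  by elim: m => [|m <-]; rewrite ?subr0 // -[LHS]bernoulli_funS -nat1r;
    congr bernoulli_fun; ring.
rewrite -(BN a.-1) -bernoulli_fun_raabe // (reindex_inj rev_ord_inj) /=.
apply: eq_bigr => i _; congr (bernoulli_fun n (_ / _)).
have -> : (a - i.+1 = a.-1 - i)%N by lia.
by rewrite natrB; [ring | rewrite -ltnS prednK].
Qed.

(** Both sides change sign under x+1: on the right the index shift gives a factor -1, and for even c
    the term that wraps around keeps the right sign. On [0,1) this is the polynomial formula. *)
Lemma euler_fun_bernoulli (R : realType) c (x : R) n : ~~ odd c -> (0 < c)%N ->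
    (0 < n)%N ->
  c%:R ^ (1 - n%:Z) * euler_fun n.-1 x =
  - (2 / n%:R) * \sum_(i < c) (-1) ^+ i * bernoulli_fun n ((x + i%:R) / c%:R).
Proof.
move=> c_even c_gt0 n_gt0; have c0 : c%:R != 0 :> R by rewrite pnatr_eq0 -lt0n.
move: x; apply: real_shift_ind => x; last first.
  move=> x01; rewrite euler_fun01 // -(euler_poly_bernoulli _ c) //.
  have -> : 1 - n%:Z = - n.-1%:Z by lia.
  rewrite prednK // -exprnN.
  under [in RHS]eq_bigr do rewrite bernoulli_fun01 ?div_itv01 //.
  by field; rewrite pnatr_eq0 -lt0n n_gt0 expf_neq0.
rewrite euler_funS.
have := sum_ord_shift R (-1) (fun i => bernoulli_fun n ((x + i%:R) / c%:R)) c.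
rewrite -(signr_odd _ c) (negbTE c_even) mul1r addr0 mulrDl divff // bernoulli_funS addrK.
under eq_bigr do rewrite -nat1r addrA.
set S := \sum_(i < c) _; set T := \sum_(i < c) _ => h.
have -> : S = - T by lra.
by split; lra.
Qed.

Lemma defect_fun (R : realType) p q (u v : R) : (0 < p)%N -> (0 < q)%N ->
  defect p q ((@bernoulli_fun R)^~ u) ((@bernoulli_fun R)^~ v) ((@bernoulli_fun R)^~ (u -
    v)) =
  defect p q ((@bernoulli_fun R)^~ (u - v)) ((@bernoulli_fun R)^~ 0)
    ((@bernoulli_fun R)^~ (u - v)).
Proof.
move=> p_gt0 q_gt0; rewrite /bernoulli_fun !floor0 subr0.
have := floor_itv u; have := floor_itv v; have := floor_itv (u - v).
rewrite !intrD.
set w := u - v - (Num.floor (u - v))%:~R; set r := u - (Num.floor u)%:~R.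
set s := v - (Num.floor v)%:~R => hw hv hu.
rewrite -(defect_const _ _ s) //.
(* With r, s, w the fractional parts of u, v, u-v, the integer m = w-r+s lies strictly between -1
   and 2. If m = 0 then r = s+w; if m = 1 then r+1 = s+w, the case of [defect_wrap]. *)
have [m wE] : exists m : int, w = r - s + m%:~R.
  exists (Num.floor u - Num.floor v - Num.floor (u - v)).
  by rewrite /w /r /s !intrB; ring.
have w01 : 0 <= w < 1 by rewrite /w; lra.
have r01 : 0 <= r < 1 by rewrite /r; lra.
have s01 : 0 <= s < 1 by rewrite /s; lra.
have [m0|m1] : m = 0 \/ m = 1.
- have : (-1)%:~R < m%:~R :> R by lra.
  have : m%:~R < 2%:~R :> R by lra.
  rewrite !ltr_int; clear; lia.
- by have -> : r = s + w by rewrite wE m0; ring.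
- by apply: defect_wrap; rewrite // wE m1; ring.
Qed.

(** * Expansion of both sides into triple sums *)

Lemma S2_raabe (R : realType) (a b c p q : nat) (x y z : R) :
    (0 < a)%N -> (0 < b)%N ->
  a%:R ^ (1 - p%:Z) * b%:R ^ (1 - q%:Z) * S2 p q a%:Z b%:Z c x y z =
  \sum_(mu < c) (-1) ^+ mu * \sum_(i < a) \sum_(j < b)
     bernoulli_fun p ((mu%:R + z) / c%:R + (x + i%:R) / a%:R)
     * bernoulli_fun q ((mu%:R + z) / c%:R + (y + j%:R) / b%:R).
Proof.
move=> a_gt0 b_gt0; have a0 : a%:R != 0 :> R by rewrite pnatr_eq0 -lt0n.
have b0 : b%:R != 0 :> R by rewrite pnatr_eq0 -lt0n.
rewrite mulr_sumr; apply: eq_bigr => mu _; set w := (_ + z) / _.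
transitivity ((-1) ^+ mu * (a%:R ^ (1 - p%:Z) * bernoulli_fun p (a%:R * w + x)
    * (b%:R ^ (1 - q%:Z) * bernoulli_fun q (b%:R * w + y)))); first by ring.
rewrite -!bernoulli_fun_raabe // mulr_suml; congr (_ * _); apply: eq_bigr => i _.
rewrite mulr_sumr; apply: eq_bigr => j _.
by congr (bernoulli_fun p _ * bernoulli_fun q _); field.
Qed.

(** The index of [S1] plays the role of k. The Euler factor at cY+z produces the sum over mu of
    Bernoulli functions at Z+Y, and the Bernoulli factor at x-aY the sum over i at X-Y. *)
Lemma S1_raabe_sub (R : realType) (a b c p q j : nat) (x y z : R) :
    (0 < a)%N -> (0 < b)%N -> (0 < c)%N -> ~~ odd c -> (0 < q)%N -> (j <= p)%N ->
  a%:R ^ (1 - j%:Z) * c%:R ^ (1 + j%:Z - p%:Z - q%:Z)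
    * S1 (p + q - j) j c%:Z (- a%:Z) b z x y =
  - (2 / (p + q - j)%:R) * \sum_(mu < c) (-1) ^+ mu * \sum_(i < a) \sum_(k < b)
     bernoulli_fun (p + q - j) ((mu%:R + z) / c%:R + (y + k%:R) / b%:R)
     * bernoulli_fun j ((x + i%:R) / a%:R - (y + k%:R) / b%:R).
Proof.
move=> a_gt0 b_gt0 c_gt0 c_even q_gt0 lejp.
have a0 : a%:R != 0 :> R by rewrite pnatr_eq0 -lt0n.
have b0 : b%:R != 0 :> R by rewrite pnatr_eq0 -lt0n.
have c0 : c%:R != 0 :> R by rewrite pnatr_eq0 -lt0n.
have -> : 1 + j%:Z - p%:Z - q%:Z = 1 - (p + q - j)%N%:Z by lia.
have : (0 < p + q - j)%N by lia.
move: (p + q - j)%N => n n_gt0.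
under [in RHS]eq_bigr do rewrite exchange_big mulr_sumr.
rewrite exchange_big /S1 !mulr_sumr; apply: eq_bigr => k _.
rewrite (addrC k%:R) !rmorphN /= mulNr; set Y := (y + k%:R) / _.
transitivity (c%:R ^ (1 - n%:Z) * euler_fun n.-1 (c%:R * Y + z)
  * (a%:R ^ (1 - j%:Z) * bernoulli_fun j (- (a%:R * Y) + x))); first by ring.
rewrite euler_fun_bernoulli // -bernoulli_fun_raabe // -!mulrA; congr (_ * _).
rewrite mulr_suml; apply: eq_bigr => mu _.
rewrite -mulrA; congr (_ * _); rewrite mulr_sumr; apply: eq_bigr => i _.
by congr (bernoulli_fun n _ * bernoulli_fun j _); field.
Qed.

(** Now the index of [S1] is i. The Bernoulli factor at bX-y is expanded with decreasing arguments,
    so that it yields the same X-Y as in the other family of sums. *)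
Lemma S1_raabe_add (R : realType) (a b c p q h : nat) (x y z : R) :
    (0 < a)%N -> (0 < b)%N -> (0 < c)%N -> ~~ odd c -> (0 < p)%N -> (h <= q)%N ->
  b%:R ^ (1 - h%:Z) * c%:R ^ (1 + h%:Z - p%:Z - q%:Z)
    * S1 (p + q - h) h c%:Z b%:Z a z (- y) x =
  - (2 / (q + p - h)%:R) * \sum_(mu < c) (-1) ^+ mu * \sum_(i < a) \sum_(k < b)
     bernoulli_fun (q + p - h) ((mu%:R + z) / c%:R + (x + i%:R) / a%:R)
     * bernoulli_fun h ((x + i%:R) / a%:R - (y + k%:R) / b%:R).
Proof.
move=> a_gt0 b_gt0 c_gt0 c_even p_gt0 lehq.
have a0 : a%:R != 0 :> R by rewrite pnatr_eq0 -lt0n.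
have b0 : b%:R != 0 :> R by rewrite pnatr_eq0 -lt0n.
have c0 : c%:R != 0 :> R by rewrite pnatr_eq0 -lt0n.
have -> : 1 + h%:Z - p%:Z - q%:Z = 1 - (p + q - h)%N%:Z by lia.
rewrite (addnC q p); have : (0 < p + q - h)%N by lia.
move: (p + q - h)%N => n n_gt0.
under [in RHS]eq_bigr do rewrite mulr_sumr.
rewrite exchange_big /S1 !mulr_sumr; apply: eq_bigr => i _.
rewrite (addrC i%:R); set X := (x + i%:R) / _.
transitivity (c%:R ^ (1 - n%:Z) * euler_fun n.-1 (c%:R * X + z)
  * (b%:R ^ (1 - h%:Z) * bernoulli_fun h (b%:R * X - y))); first by ring.
rewrite euler_fun_bernoulli // -bernoulli_fun_raabeN // -!mulrA; congr (_ * _).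
rewrite mulr_suml; apply: eq_bigr => mu _.
rewrite -mulrA; congr (_ * _); rewrite mulr_sumr; apply: eq_bigr => k _.
by congr (bernoulli_fun n _ * bernoulli_fun h _); field.
Qed.

Theorem theorem4 (R : realType) (a b c : nat)
  (ha : (0 < a)%N) (hb : (0 < b)%N) (hc : (0 < c)%N) (hceven : ~~ odd c)
  (p q : nat) (hp : (1 <= p)%N) (hq : (1 <= q)%N) (x y z : R) :
  (a%:R : R) ^ (1 - p%:Z) * (b%:R : R) ^ (1 - q%:Z)
    * S2 p q (a%:Z) (b%:Z) c x y z
  = - (q%:R / 2) * \sum_(j < p.+1)
        'C(p, j)%:R * (a%:R : R) ^ (1 - j%:Z)
          * (c%:R : R) ^ (1 + j%:Z - p%:Z - q%:Z)
          * S1 (p + q - j) j (c%:Z) (- a%:Z) b z x y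
    - (p%:R / 2) * \sum_(h < q.+1)
        'C(q, h)%:R * (-1) ^+ h * (b%:R : R) ^ (1 - h%:Z)
          * (c%:R : R) ^ (1 + h%:Z - p%:Z - q%:Z)
          * S1 (p + q - h) h (c%:Z) (b%:Z) a z (- y) x.
Proof.
pose Z (mu : 'I_c) := (mu%:R + z) / c%:R.
pose X (i : 'I_a) := (x + i%:R) / a%:R.
pose Y (k : 'I_b) := (y + k%:R) / b%:R.
pose B (w : R) n := bernoulli_fun n w.
rewrite S2_raabe //.
(* The factor -q/2 meets -2/(p+q-j) from the Euler expansion, leaving the q/(p+q-j) of Nielsen's
   formula. *)
have -> : - (q%:R / 2) * \sum_(j < p.+1)
        'C(p, j)%:R * (a%:R : R) ^ (1 - j%:Z)
          * (c%:R : R) ^ (1 + j%:Z - p%:Z - q%:Z)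
          * S1 (p + q - j) j (c%:Z) (- a%:Z) b z x y =
   \sum_(mu < c) (-1) ^+ mu * \sum_(i < a) \sum_(k < b)
     q%:R * convol p q (B (Z mu + Y k)) (B (X i - Y k)).
  transitivity (\sum_(j < p.+1) \sum_(mu < c) (-1) ^+ mu * \sum_(i < a) \sum_(k < b)
     q%:R * ('C(p, j)%:R / (p + q - j)%:R * B (Z mu + Y k) (p + q - j)%N * B (X i - Y k)
       j)).
    rewrite mulr_sumr; apply: eq_bigr => j _.
    have lejp : (j <= p)%N by rewrite -ltnS.
    have := S1_raabe_sub R a b c p q j x y z ha hb hc hceven hq lejp.
    move: (S1 _ _ _ _ _ _ _ _) => S E.
    rewrite -2!(mulrA 'C(_, _)%:R) E.
    rewrite [RHS](_ : _ = q%:R * 'C(p, j)%:R / (p + q - j)%:R * \sum_(mu < c) (-1)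
      ^+ mu * \sum_(i < a) \sum_(k < b)
      (B (Z mu + Y k) (p + q - j)%N * B (X i - Y k) j)).
      by rewrite !mulrA; congr (_ * _); field; rewrite pnatr_eq0; lia.
    rewrite mulr_sumr; apply: eq_bigr => mu _; rewrite mulrCA; congr (_ * _).
    rewrite mulr_sumr; apply: eq_bigr => i _; rewrite mulr_sumr; apply: eq_bigr => k _.
    by rewrite !mulrA.
  rewrite exchange_big; apply: eq_bigr => mu _; rewrite -mulr_sumr; congr (_ * _).
  rewrite exchange_big; apply: eq_bigr => i _; rewrite exchange_big; apply: eq_bigr => k _.
  by rewrite -mulr_sumr.
have -> : p%:R / 2 * \sum_(h < q.+1)
        'C(q, h)%:R * (-1) ^+ h * (b%:R : R) ^ (1 - h%:Z)
          * (c%:R : R) ^ (1 + h%:Z - p%:Z - q%:Z)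
          * S1 (p + q - h) h (c%:Z) (b%:Z) a z (- y) x =
   - \sum_(mu < c) (-1) ^+ mu * \sum_(i < a) \sum_(k < b)
     p%:R * convol q p (B (Z mu + X i)) (fun h => (-1) ^+ h * B (X i - Y k) h).
  transitivity (\sum_(h < q.+1) - \sum_(mu < c) (-1) ^+ mu * \sum_(i < a) \sum_(k < b)
     p%:R * ('C(q, h)%:R / (q + p - h)%:R * B (Z mu + X i) (q + p - h)%N * ((-1) ^+ h *
       B (X i - Y k) h))).
    rewrite mulr_sumr; apply: eq_bigr => h _.
    have lehq : (h <= q)%N by rewrite -ltnS.
    have := S1_raabe_add R a b c p q h x y z ha hb hc hceven hp lehq.
    move: (S1 _ _ _ _ _ _ _ _) => S E.
    rewrite -3!(mulrA 'C(_, _)%:R) -2!(mulrA ((-1) ^+ h)) E.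
    rewrite [RHS](_ : _ = - (p%:R * 'C(q, h)%:R * (-1) ^+ h / (q + p - h)%:R *
      \sum_(mu < c) (-1) ^+ mu * \sum_(i < a) \sum_(k < b)
      (B (Z mu + X i) (q + p - h)%N * B (X i - Y k) h))).
      by rewrite -[RHS]mulNr !mulrA; congr (_ * _); field; rewrite pnatr_eq0; lia.
    congr (- _); rewrite mulr_sumr; apply: eq_bigr => mu _.
    rewrite [RHS]mulrCA; congr (_ * _).
    rewrite mulr_sumr; apply: eq_bigr => i _; rewrite mulr_sumr; apply: eq_bigr => k _.
    by move: (B _ _) (B _ _) (_^-1) => u v w; ring.
  rewrite sumrN exchange_big; congr (- _); apply: eq_bigr => mu _; rewrite -mulr_sumr;
    congr (_ * _).
  rewrite exchange_big; apply: eq_bigr => i _; rewrite exchange_big; apply: eq_bigr => k _.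
  by rewrite -mulr_sumr.
rewrite opprK -big_split -[RHS]addr0 /=.
apply/eqP; rewrite addr0 -subr_eq0 -sumrB; apply/eqP.
(* The difference of the two sides is a signed sum of defects; after [defect_fun] its inner double
   sum is free of mu and factors out. *)
transitivity (\sum_(mu < c) (-1) ^+ mu * \sum_(i < a) \sum_(k < b)
  defect p q (B (X i - Y k)) (B 0) (B (X i - Y k))).
  apply: eq_bigr => mu _; rewrite -mulrDr -mulrBr; congr (_ * _).
  rewrite -big_split -sumrB; apply: eq_bigr => i _.
  rewrite -big_split -sumrB; apply: eq_bigr => k _ /=.
  have := defect_fun R p q (Z mu + X i) (Z mu + Y k) hp hq.
  have -> : Z mu + X i - (Z mu + Y k) = X i - Y k by ring.
  by rewrite /B => <-; rewrite /defect opprD addrA.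
by rewrite -mulr_suml sum_sign_even // mul0r.
Qed.
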